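(* For every integer $k>0$ and every real number $C$, $$\liminf_{q\to\infty}\ \mathbb{P}\bigl(\mathrm{Diam}(q,k) > C\, q^{1/k}\bigr) > 0,$$ where $q$ ranges over the prime numbers and $\mathrm{Diam}(q,k)$ is the diameter of the directed Cayley graph of the cyclic group $\mathbb{Z}_q$ with respect to $k$ generators $g_1,\dots,g_k$ chosen independently and uniformly at random from $\mathbb{Z}_q$.
   Context: For a finite group $G$ and a subset $S\subseteq G$, the (directed) Cayley graph of $G$ with respect to $S$ is the graph with vertex set $G$ and edge set $E$ where $(g,h)\in E$ if and only if $h^{-1}g\in S$. For a prime $q$, $\mathbb{Z}_q$ is the (additive) cyclic group of order $q$. Let $g_1,\dots,g_k$ be independent and uniformly distributed on $\mathbb{Z}_q$. $\mathrm{Diam}(q,k)$ is the random variable equal to the diameter of the directed Cayley graph of $\mathbb{Z}_q$ with respect to $\{g_1,\dots,g_k\}$, i.e. the maximum over ordered pairs of vertices of the directed graph distance. Convention: the diameter is $+\infty$ if some vertex is not reachable from another, which happens only when all $g_i=0$.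
   Formalization: For k = 1 the claim is proved only for C < 1; for k = 1 and C ≥ 1 it is false, since a single nonzero generator gives diameter q − 1 < Cq, so the probability is 1/q and the liminf is 0. *)

(* Defs.v *)
From HB Require Import structures.
From mathcomp Require Import all_boot all_order all_algebra all_fingroup.
From mathcomp Require Import all_classical all_reals all_analysis.

Set Implicit Arguments.
Unset Strict Implicit.
Unset Printing Implicit Defensive.

Import Order.TTheory GRing.Theory Num.Theory.

Local Open Scope classical_set_scope.
Local Open Scope ring_scope.

(* The edge goes from g to h when h^-1 g lies in S, so a step multiplies by the
   inverse of an element of S on the right. *)
Definition cayley (gT : finGroupType) (S : {set gT}) : rel gT :=
  fun g h => (h^-1 * g)%g \in S.

Section DirectedDiameter.
Context (R : realType) (T : finType).
Implicit Types (e : rel T) (x y : T).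

(* Since ereal_inf set0 = +oo, an unreachable y is at distance +oo from x. *)
Definition gdist e x y : \bar R :=
  ereal_inf [set (size p)%:R%:E | p in [set p | path e x p /\ last x p = y]].

Definition diam e : \bar R := ereal_sup [set gdist e z.1 z.2 | z in setT].

End DirectedDiameter.

Section RandomElements.
Context d (Omega : measurableType d) (R : realType) (P : probability Omega R).

(* Measurability with respect to the discrete sigma-algebra on T. *)
Definition discrete_rv (T : Type) (X : Omega -> T) : Prop :=
  forall A : set T, measurable (X @^-1` A).

Definition uniform_rv (T : finType) (X : Omega -> T) : Prop :=
  forall x : T, P (X @^-1` [set x]) = (#|T|%:R^-1)%:E.

Definition mutually_independent (I : finType) (T : Type)
    (X : I -> Omega -> T) : Prop :=
  forall (J : {set I}) (A : I -> set T),
    P (\bigcap_(i in [set` J]) (X i @^-1` A i)) =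
    (\prod_(i in J) P (X i @^-1` A i))%E.

Definition iid_uniform (I T : finType) (X : I -> Omega -> T) : Prop :=
  [/\ forall i, discrete_rv (X i),
      forall i, uniform_rv (X i)
    & mutually_independent X].

End RandomElements.

(* For prime q, 'Z_q has q elements and its group law is addition modulo q. *)
Definition Diam (R : realType) (q k : nat) (g : 'I_k -> 'Z_q) : \bar R :=
  diam R (cayley [set x in codom g]%SET).

(* 'Z_q is not the integers modulo q when q < 2, but only prime q belong to the
   filter. *)
Definition primes_oo : set_system nat := within [set` prime] \oo.

(* Main.v *)
(* For k = 1 the diameter is at least q - 1.  For k >= 2, call a relation
   sum_i a_i g_i = 0 with 1 <= a_i <= M short, where M is about eps q^(1/k).
   A short relation forces a large diameter: subtracting multiples of it from
   sum_i b_i g_i at a coordinate j maximising a makes b_j < a_j <= M and moves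
   the other coefficients by at most sum_i b_i, so at most M (2L+1)^(k-1)
   elements are reached within distance L, which is less than q for
   L ~ C q^(1/k) and eps small.
   A short relation exists with probability bounded below: restrict to the
   vectors a with a_0 and a_1 coprime, which are at least a quarter of the
   M^k vectors and are pairwise not proportional, even modulo q as M^2 < q.
   Each hyperplane a.g = 0 has at least q^(k-1) points, two of them meet in at
   most q^(k-2) points, and Bonferroni's inequality bounds their union from
   below by a constant times M^k q^(k-1). *)
Require Import Defs.
From mathcomp Require Import all_boot all_order all_algebra all_fingroup.
From mathcomp Require Import all_classical all_reals all_analysis.
From mathcomp Require Import zify ring lra.

Import Order.TTheory GRing.Theory Num.Theory.

Local Open Scope ring_scope.

Set Implicit Arguments.
Unset Strict Implicit.
Unset Printing Implicit Defensive.

(** * Covering bound from a short relation *)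

Lemma card_le_relation (V : finZmodType) n (g : 'I_n.+1 -> V)
    (a : 'I_n.+1 -> nat) (M L : nat) :
  (forall i, 0 < a i <= M)%N -> \sum_i g i *+ a i = 0 ->
  (forall v : V, exists b : 'I_n.+1 -> nat,
     (\sum_i b i <= L)%N /\ v = \sum_i g i *+ b i) ->
  (#|V| <= M * (2 * L).+1 ^ n)%N.
Proof.
move=> aM a0 cover.
have [j _ jmax] := @arg_maxnP _ ord0 xpredT a isT.
(* [c.1] will be the remainder of [b j] modulo [a j]; the other reduced coefficients lie in [-L, L]
   and are stored shifted by [L], hence the [2 * L + 1] values. *)
pose h (c : 'I_M * {ffun 'I_n -> 'I_(2 * L).+1}) : V :=
  g j *+ c.1 + \sum_i (g (lift j i) *+ c.2 i - g (lift j i) *+ L).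
suff hsurj v : v \in codom h.
  rewrite -[(2 * L).+1]card_ord -[M]card_ord -[n in (_ ^ n)%N]card_ord.
  rewrite -card_ffun -card_prod; apply: leq_trans (leq_image_card h _).
  by apply/subset_leq_card/fintype.subsetP => v _; exact: hsurj.
have [b [bL ->]] := cover v.
have b_le i : (b i <= L)%N.
  by apply: leq_trans bL; rewrite (bigD1 i) //= leq_addr.
have aj0 : (0 < a j)%N by case/andP: (aM j).
have rM : (b j %% a j < M)%N.
  by apply: leq_trans (ltn_pmod _ aj0) _; case/andP: (aM j).
pose t := (b j %/ a j)%N.
(* Maximality of [a j] gives [t * a i <= t * a j <= b j], so the natural subtraction in the witness
   is not truncated. *)
have taL i : (t * a i <= L)%N.
  apply: leq_trans (b_le j); apply: leq_trans (leq_trunc_div (b j) (a j)).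
  by rewrite leq_mul2l; apply/orP; right; exact: jmax.
apply/codomP.
exists (Ordinal rM, [ffun i => inord (b (lift j i) + L - t * a (lift j i))]).
have -> : \sum_i g i *+ b i = \sum_i (g i *+ b i - g i *+ (t * a i)).
  rewrite sumrB; under [X in _ - X]eq_bigr do rewrite mulnC mulrnA.
  by rewrite sumrMnl a0 mul0rn subr0.
rewrite /h /= (bigD1_ord j) //=.
have -> : g j *+ b j - g j *+ (t * a j) = g j *+ (b j %% a j).
  by rewrite {1}(divn_eq (b j) (a j)) mulrnDr addrC addKr.
apply: (congr1 (fun x => g j *+ (b j %% a j) + x)); apply: eq_bigr => i _.
rewrite ffunE inordK; last by rewrite ltnS; have := b_le (lift j i); lia.
rewrite mulrnBr; last by have := taL (lift j i); lia.
by rewrite mulrnDr addrAC addrK.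
Qed.

(** * Bonferroni's inequality *)

(** Both sides are sums over points of [T] and are compared point by point. The double sum runs over
    ordered pairs, hence the factors 2. *)
Lemma bonferroni (I T : finType) (A : {set I}) (H : I -> {set T}) :
  (2 * (\sum_(a in A) #|H a|) <= 2 * #|\bigcup_(a in A) H a| +
     \sum_(a in A) \sum_(b in A | b != a) #|H a :&: H b|)%N.
Proof.
have cardE (X : {set T}) : #|X| = (\sum_x (x \in X))%N.
  by rewrite -sum1_card big_mkcond.
under eq_bigr do rewrite cardE.
rewrite exchange_big /= cardE.
under [X in (_ <= _ + X)%N]eq_bigr => a _.
  under eq_bigr do rewrite cardE.
  rewrite exchange_big /=; over.
rewrite [X in (_ <= _ + X)%N]exchange_big !big_distrr /= -big_split /=.
apply: leq_sum => x _.
(* With N sets containing x, this is 2 N <= 2 [N > 0] + N (N - 1). *)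
pose B := [set a in A | x \in H a].
have sumB : (\sum_(a in A) (x \in H a) = #|B|)%N.
  rewrite -sum1_card big_mkcond [RHS]big_mkcond; apply: eq_bigr => a _.
  by rewrite !inE; case: (a \in A).
have -> : (\sum_(a in A) \sum_(b in A | b != a) (x \in H a :&: H b) =
   #|B| * #|B|.-1)%N.
  rewrite -{1}sum1_card big_distrl /= [RHS]big_mkcond [LHS]big_mkcond /=.
  apply: eq_bigr => a _; rewrite inE; case: (boolP (a \in A)) => //= aA.
  case: (boolP (x \in H a)) => [xa|xa]; last first.
    by rewrite big1 // => b _; rewrite inE (negPf xa).
  rewrite mul1n (cardD1 a B) inE aA xa /= -sum1_card big_mkcond [RHS]big_mkcond /=.
  apply: eq_bigr => b _; rewrite !inE xa /= andbC.
  by case: (b == a); case: (b \in A); case: (x \in H b).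
rewrite sumB; case: (posnP #|B|) => [-> //|B0].
have -> : x \in \bigcup_(a in A) H a.
  case/card_gt0P: B0 => a; rewrite inE => /andP[aA xa].
  by apply/finset.bigcupP; exists a.
by case: #|B| B0 => //= -[|m] _; nia.
Qed.

(** * Density of vectors with coprime first entries *)

Lemma card_ord_dvdn (M d : nat) : #|[pred i : 'I_M | (d %| i.+1)%N]| = (M %/ d)%N.
Proof.
by rewrite divn_count_dvd big_add1 big_mkord -sum1_card big_mkcond.
Qed.

Lemma sum_inv_sqr (F : realFieldType) (M : nat) :
  \sum_(2 <= d < M.+1) (d%:R ^+ 2)^-1 <= 3 / 4 :> F.
Proof.
(* The subtracted term makes the induction telescope, as 1/(x+1)^2 <= 1/x - 1/(x+1). The constant
   3/4 gives equality at the start: 1/4 = 3/4 - 1/2. *)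
have key m : \sum_(2 <= d < m.+3) (d%:R ^+ 2)^-1 <= 3 / 4 - (m.+2%:R)^-1 :> F.
  elim: m => [|m IH]; first by rewrite big_nat1; lra.
  rewrite big_nat_recr //=; apply: le_trans (lerD IH (lexx _)) _.
  have m0 : 0 < m.+2%:R :> F by rewrite ltr0n.
  rewrite -[m.+3%:R]natr1; move: (m.+2%:R) m0 => x x0.
  have x1 : 0 < x + 1 by lra.
  have -> : x^-1 = (x + 1)^-1 + (x * (x + 1))^-1.
    by field; rewrite ?gt_eqF.
  have : ((x + 1) ^+ 2)^-1 <= (x * (x + 1))^-1.
    by rewrite lef_pV2 ?posrE ?mulr_gt0 ?exprn_gt0 //; nra.
  lra.
case: M => [|[|M]]; [by rewrite big_geq //; lra..|].
apply: le_trans (key M) _; rewrite gerBl invr_ge0; exact: ler0n.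
Qed.

(** [(M %/ d) ^ 2] counts the pairs in [1, M]^2 with both entries divisible by [d]; a total below
    M^2 is what leaves a positive share of coprime pairs. *)
Lemma sum_divn_sqr (M : nat) :
  (4 * \sum_(2 <= d < M.+1) (M %/ d) ^ 2 <= 3 * M ^ 2)%N.
Proof.
rewrite -(ler_nat rat) !natrM natr_sum.
have : \sum_(2 <= d < M.+1) ((M %/ d) ^ 2)%N%:R <=
    M%:R ^+ 2 * \sum_(2 <= d < M.+1) (d%:R ^+ 2)^-1 :> rat.
  rewrite big_distrr /= big_nat_cond [leRHS]big_nat_cond.
  apply: ler_sum => d /andP[/andP[d2 _] _].
  rewrite natrX -exprVn -exprMn.
  apply: lerXn2r; rewrite ?nnegrE ?mulr_ge0 ?invr_ge0 ?ler0n //.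
  by rewrite ler_pdivlMr ?ltr0n; [rewrite -natrM ler_nat leq_trunc_div|lia].
move=> /le_trans le.
have {}le := le _ (ler_wpM2l (exprn_ge0 2 (ler0n _ M)) (sum_inv_sqr _ M)).
by rewrite expr2 in le; lra.
Qed.

(* An entry i : 'I_M stands for the coefficient i + 1 in [1, M]. *)
Definition coprime_vectors n M : {set {ffun 'I_n.+2 -> 'I_M}} :=
  [set a : {ffun 'I_n.+2 -> 'I_M} | coprime (a ord0).+1 (a (lift ord0 ord0)).+1].

(** In every other vector the first two entries share a divisor d in [2, M]; the union bound over d
    costs at most 3/4 of all vectors. *)
Lemma card_coprime_vectors n M : (M ^ n.+2 <= 4 * #|coprime_vectors n M|)%N.
Proof.
pose B d := [set a : {ffun 'I_n.+2 -> 'I_M} |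
  (d %| (a ord0).+1) && (d %| (a (lift ord0 ord0)).+1)]%N.
have cardB d : #|B d| = ((M %/ d) ^ 2 * M ^ n)%N.
  pose F (i : 'I_n.+2) : pred 'I_M :=
    if (i < 2)%N then [pred x : 'I_M | d %| x.+1]%N else predT.
  have -> : #|B d| = #|(family F : simpl_pred {ffun 'I_n.+2 -> 'I_M})|.
    apply: eq_card => a; rewrite inE; apply/andP/familyP => [[a0 a1] i|aF].
      rewrite /F; case: ifP => // i2; rewrite inE.
      have [->|->] // : i = ord0 \/ i = lift ord0 ord0.
      by case: i i2 => -[|[|]] // ? _; [left|right]; apply: val_inj.
    by split; [have := aF ord0|have := aF (lift ord0 ord0)].
  rewrite card_family foldrE big_map big_enum /= !big_ord_recl /= !card_ord_dvdn.
  rewrite (eq_bigr (fun=> M)) => [|i _]; last by rewrite card_ord.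
  by rewrite prod_nat_const card_ord mulnA mulnn.
have sub : [set: {ffun 'I_n.+2 -> 'I_M}] \subset
    coprime_vectors n M :|: \bigcup_(d < M.+1 | (2 <= d)%N) B d.
  apply/fintype.subsetP => a _; rewrite !inE; case: (boolP (coprime _ _)) => //= ncop.
  pose p := pdiv (gcdn (a ord0).+1 (a (lift ord0 ord0)).+1).
  have g1 : (1 < gcdn (a ord0).+1 (a (lift ord0 ord0)).+1)%N.
    by rewrite ltn_neqAle eq_sym ncop gcdn_gt0.
  have := pdiv_dvd (gcdn (a ord0).+1 (a (lift ord0 ord0)).+1).
  rewrite -/p dvdn_gcd => pd.
  have pM : (p < M.+1)%N.
    rewrite ltnS; apply: leq_trans (ltn_ord (a ord0)).
    by apply: dvdn_leq => //; case/andP: pd.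
  apply/finset.bigcupP; exists (Ordinal pM); last by rewrite inE.
  exact: prime_gt1 (pdiv_prime g1).
have := leq_trans (subset_leq_card sub) (leq_card_setU _ _).
rewrite cardsT card_ffun !card_ord => le.
have le2 : (#|\bigcup_(d < M.+1 | (2 <= d)%N) B d| <=
    \sum_(2 <= d < M.+1) (M %/ d) ^ 2 * M ^ n)%N.
  rewrite (big_nat_widenl 2 0) // big_mkord.
  elim/big_ind2: _ => [|x1 x2 y1 y2 h1 h2|d _].
  - by rewrite cards0.
  - by apply: leq_trans (leq_card_setU _ _) _; exact: leq_add.
  - by rewrite cardB.
rewrite -big_distrl /= in le2.
have := leq_mul (sum_divn_sqr M) (leqnn (M ^ n)).
have E : (M ^ n.+2 = M ^ 2 * M ^ n)%N by rewrite -expnD.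
rewrite {}E in le *; move: le le2; move: (M ^ 2)%N (M ^ n)%N => x y.
move: #|coprime_vectors n M| #|\bigcup_(d < M.+1 | _) _| => c u.
move: (\sum_(2 <= d < M.+1) _)%N => s; nia.
Qed.

(** * Hyperplanes over finite rings and their intersections *)

(** The last [n] coordinates are free: the unit [u ord0] allows solving for the first one, which is
    what [h] does. *)
Lemma card_hyperplane (R : finComUnitRingType) n (u : 'I_n.+1 -> R) :
  u ord0 \is a GRing.unit ->
  (#|R| ^ n <= #|[set g : {ffun 'I_n.+1 -> R} | \sum_i u i * g i == 0]%R|)%N.
Proof.
move=> u0.
pose h (c : {ffun 'I_n -> R}) : {ffun 'I_n.+1 -> R} :=
  [ffun i => if unlift ord0 i is Some j then c j
             else - (u ord0)^-1 * \sum_j u (lift ord0 j) * c j].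
have h_inj : injective h.
  move=> c d /ffunP hcd; apply/ffunP => j.
  by have := hcd (lift ord0 j); rewrite !ffunE liftK.
rewrite -[n in (_ ^ n)%N]card_ord -card_ffun -(card_codom h_inj).
apply/subset_leq_card/fintype.subsetP => _ /codomP[c ->]; rewrite inE big_ord_recl.
rewrite ffunE unlift_none mulrA mulrN divrr // mulN1r addrC subr_eq0.
by apply/eqP/eq_bigr => j _; rewrite ffunE liftK.
Qed.

(** Cramer's rule: with an invertible minor the coordinates [i] and [j] are determined by the
    remaining [n], so the restriction [f] is injective on the intersection. *)
Lemma card_hyperplaneI (R : finComUnitRingType) n (u v : 'I_n.+2 -> R) i j :
  u i * v j - u j * v i \is a GRing.unit ->
  (#|[set g : {ffun 'I_n.+2 -> R} |
       (\sum_i u i * g i == 0) && (\sum_i v i * g i == 0)]%R| <= #|R| ^ n)%N.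
Proof.
move=> minor.
have [j' jE] : exists j', j = lift i j'.
  case: (unliftP i j) => [j' ->|ji]; first by exists j'.
  by rewrite ji mulrC subrr unitr0 in minor.
pose f (g : {ffun 'I_n.+2 -> R}) := [ffun l : 'I_n => g (lift i (lift j' l))].
rewrite -[n in (_ ^ n)%N]card_ord -card_ffun; apply: (@leq_card_in _ _ f).
have sumE (w : 'I_n.+2 -> R) (g : {ffun 'I_n.+2 -> R}) : \sum_i w i * g i =
    w i * g i + (w j * g j + \sum_l w (lift i (lift j' l)) * f g l).
  rewrite (bigD1_ord i) //= (bigD1_ord j') //= -jE.
  by under [in RHS]eq_bigr do rewrite ffunE.
move=> g h; rewrite !inE !sumE => /andP[/eqP ug /eqP vg] /andP[/eqP uh /eqP vh] fgh.
rewrite fgh in ug vg; have {uh}ug := etrans ug (esym uh).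
have {vh}vg := etrans vg (esym vh).
have eq0 x : (u i * v j - u j * v i) * x = 0 -> x = 0.
  by move/(congr1 ( *%R (u i * v j - u j * v i)^-1)); rewrite mulKr // mulr0.
move: ug vg; rewrite !addrA => /addIr ug /addIr vg.
have gi : g i = h i.
  apply/eqP; rewrite -subr_eq0; apply/eqP/eq0.
  (* This combination of the two equations eliminates the coordinate [j] and leaves the minor times
     [g i - h i]. *)
  transitivity (v j * (u i * g i + u j * g j) - u j * (v i * g i + v j * g j) -
    (v j * (u i * h i + u j * h j) - u j * (v i * h i + v j * h j))); first by ring.
  by rewrite ug vg subrr.
have gj : g j = h j.
  apply/eqP; rewrite -subr_eq0; apply/eqP/eq0.
  transitivity (u i * (v i * g i + v j * g j) - v i * (u i * g i + u j * g j) -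
    (u i * (v i * h i + v j * h j) - v i * (u i * h i + u j * h j))); first by ring.
  by rewrite ug vg subrr.
apply/ffunP => l; case: (unliftP i l) => [l' ->|-> //].
case: (unliftP j' l') => [l'' ->|->]; last by rewrite -jE.
by move/ffunP/(_ l''): fgh; rewrite !ffunE.
Qed.

(** * Counting generator tuples with a short relation *)

Definition relation_hyperplane q n M (a : {ffun 'I_n -> 'I_M}) :
    {set {ffun 'I_n -> 'Z_q}} :=
  [set g : {ffun 'I_n -> 'Z_q} | \sum_i g i *+ (a i).+1 == 0].

Lemma card_prime_Zp q : prime q -> #|'Z_q| = q.
Proof. by move=> pq; rewrite card_ord Zp_cast ?prime_gt1. Qed.

Lemma unit_natrB_Zp q x y : prime q -> (x < q)%N -> (y < q)%N -> x != y ->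
  (x%:R - y%:R : 'Z_q) \is a GRing.unit.
Proof.
move=> pq; wlog lexy : x y / (y <= x)%N => [hwlog xq yq xy|xq yq xy].
  case/orP: (leq_total y x) => le; first exact: hwlog.
  by rewrite -opprB unitrN; apply: hwlog => //; rewrite eq_sym.
rewrite -natrB // unitZpE ?prime_gt1 // prime_coprime //.
by apply/negP => /dvdn_leq; lia.
Qed.

Lemma coprime_vectors_minor n M (a b : {ffun 'I_n.+2 -> 'I_M}) :
  a \in coprime_vectors n M -> b \in coprime_vectors n M -> a != b ->
  exists i j, ((a i).+1 * (b j).+1 != (a j).+1 * (b i).+1)%N.
Proof.
rewrite !inE => ca cb ab.
case: (pickP (fun p => (a p.1).+1 * (b p.2).+1 != (a p.2).+1 * (b p.1).+1)%N).
  by case=> i j ij; exists i, j.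
move=> nominor; case/eqP: ab.
have par i j : ((a i).+1 * (b j).+1 = (a j).+1 * (b i).+1)%N.
  by apply/eqP/negPn; rewrite (nominor (i, j)).
(* From a_0 b_1 = a_1 b_0, coprimality of each vector's first two entries gives a_0 | b_0 and b_0 |
   a_0; then all entries agree. *)
have b0 : (a ord0).+1 = (b ord0).+1.
  apply/eqP; rewrite eqn_dvd; apply/andP; split.
    by rewrite -(Gauss_dvdr _ ca) -par dvdn_mulr.
  by rewrite -(Gauss_dvdl _ cb) par dvdn_mull.
apply/ffunP => j; apply/val_inj/succn_inj.
by have /eqP := par ord0 j; rewrite b0 mulnC eqn_pmul2r // => /eqP ->.
Qed.

(** Bonferroni over the coprime vectors [A] gives |A| q^(n+1) <= 2 |union|; together with M^(n+2) <=
    4 |A| this explains the 8. *)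
Lemma card_bigcup_relation_hyperplane q n M : prime q -> (M ^ n.+2 < q)%N ->
  (M ^ n.+2 * q ^ n.+1 <=
     8 * #|\bigcup_(a : {ffun 'I_n.+2 -> 'I_M}) relation_hyperplane q a|)%N.
Proof.
move=> pq Mq; pose A := coprime_vectors n M.
have q1 : (1 < q)%N := prime_gt1 pq.
(* Products of two coefficients stay below [q], so a nonzero integer minor is a unit modulo [q]. *)
have M2q : (M * M < q)%N.
  by apply: leq_ltn_trans Mq; case: (M) => // m; rewrite mulnn leq_pexp2l.
have hypE (a : {ffun 'I_n.+2 -> 'I_M}) : relation_hyperplane q a =
    [set g : {ffun 'I_n.+2 -> 'Z_q} | \sum_i (a i).+1%:R * g i == 0].
  by apply/setP => g; rewrite !inE; under eq_bigr do rewrite -mulr_natl.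
have lower (a : {ffun 'I_n.+2 -> 'I_M}) : (q ^ n.+1 <= #|relation_hyperplane q a|)%N.
  rewrite hypE -[q in (q ^ _)%N]card_prime_Zp //; apply: card_hyperplane.
  rewrite -[X in X \is a _]subr0 -[0]/(0%:R); apply: unit_natrB_Zp => //.
    by have := ltn_ord (a ord0); nia.
  exact: ltnW.
have upper a b : a \in A -> b \in A -> b != a ->
    (#|relation_hyperplane q a :&: relation_hyperplane q b| <= q ^ n)%N.
  move=> aA bA ba; rewrite eq_sym in ba.
  have [i [j ij]] := coprime_vectors_minor aA bA ba.
  rewrite !hypE -[q in (q ^ _)%N]card_prime_Zp //.
  rewrite (eq_card (B := mem [set g : {ffun 'I_n.+2 -> 'Z_q} |
    (\sum_i (a i).+1%:R * g i == 0%R) && (\sum_i (b i).+1%:R * g i == 0%R)])); last first.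
    by move=> g; rewrite !inE.
  apply: (@card_hyperplaneI _ _ _ _ i j); rewrite -!natrM; apply: unit_natrB_Zp => //.
    by have := ltn_ord (a i); have := ltn_ord (b j); nia.
  by have := ltn_ord (a j); have := ltn_ord (b i); nia.
have := bonferroni A (@relation_hyperplane q _ _).
have sum_lower : (#|A| * q ^ n.+1 <= \sum_(a in A) #|relation_hyperplane q a|)%N.
  by rewrite -sum_nat_const; apply: leq_sum.
have sum_upper : (\sum_(a in A) \sum_(b in A | b != a)
    #|relation_hyperplane q a :&: relation_hyperplane q b| <= #|A| * q ^ n.+1)%N.
  rewrite -sum_nat_const; apply: leq_sum => a aA.
  (* Each [a] meets at most |A| others in at most q^n points, and |A| <= M^(n+2) < q absorbs one
     factor. *)
  apply: (@leq_trans (#|A| * q ^ n)); last first.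
    rewrite expnS leq_mul2r; apply/orP; right; apply: leq_trans (ltnW Mq).
    by apply: leq_trans (max_card _) _; rewrite card_ffun !card_ord.
  rewrite -sum_nat_const big_mkcondr /=; apply: leq_sum => b bA.
  by case: ifP => // ba; exact: upper.
have cupS : (#|\bigcup_(a in A) relation_hyperplane q a| <=
    #|\bigcup_(a : {ffun 'I_n.+2 -> 'I_M}) relation_hyperplane q a|)%N.
  apply/subset_leq_card/finset.bigcupsP => a _; exact: finset.bigcup_sup.
have := leq_mul (card_coprime_vectors n M) (leqnn (q ^ n.+1)); rewrite -/A.
lia.
Qed.

Local Open Scope classical_set_scope.

(** * Walks in the Cayley graph and the diameter *)

(** Each edge subtracts a generator, and by commutativity only the number [b i] of uses of each
    generator matters. *)
Lemma path_cayley_codom (V : finZmodType) k (g : 'I_k -> V) (x : V) (p : seq V) :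
  path (cayley [set y in codom g]%SET) x p ->
  exists b : 'I_k -> nat,
    (\sum_i b i = size p)%N /\ last x p = x - \sum_i g i *+ b i.
Proof.
elim: p x => [x _|y p IH x /= /andP[xy /IH[b [<- ->]]]].
  by exists (fun=> 0%N); rewrite !big1 // subr0.
move: xy; rewrite /cayley inE => /codomP[j xyE].
have {xyE}xyE : y = x - g j.
  by rewrite -xyE FinRing.zmodMgE FinRing.zmodVgE opprD opprK addrC subrK.
exists (fun i => (i == j) + b i)%N; split.
  by rewrite big_split (bigD1 j) //= eqxx big1 // => i /negPf ->.
under [in RHS]eq_bigr do rewrite mulrnDr.
rewrite big_split /= [X in _ = _ - (X + _)](bigD1 j) //= eqxx.
rewrite [X in _ + X + _]big1 ?addr0 => [|i /negPf -> //].
by rewrite xyE opprD addrA.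
Qed.

Lemma Diam_le_cover (R : realType) q k (g : 'I_k -> 'Z_q) (x : R) (v : 'Z_q) :
  (Diam R g <= x%:E)%E ->
  exists b : 'I_k -> nat,
    (\sum_i b i <= Num.trunc (x + 1))%N /\ v = \sum_i g i *+ b i.
Proof.
move=> gx.
(* The target is [- v] because steps subtract. The slack 1 makes the inequality strict, so that the
   infimum yields an actual path. *)
have : (gdist R (cayley [set y in codom g]%SET) 0%R (- v)%R < (x + 1)%:E)%E.
  apply: (@le_lt_trans _ _ x%:E); last by rewrite lte_fin ltrDl.
  by apply: le_trans gx; apply: ereal_sup_ubound; exists (0%R, (- v)%R).
case/ereal_inf_lt => _ [p [px vp] <-]; rewrite lte_fin => px1.
have [b [bp]] := path_cayley_codom px; rewrite vp sub0r => /oppr_inj vb.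
by exists b; rewrite bp truncn_ge_nat ?(ltW px1) // (le_trans _ (ltW px1)).
Qed.

Lemma Diam_gt_relation (R : realType) q n M (a : {ffun 'I_n.+1 -> 'I_M})
    (g : {ffun 'I_n.+1 -> 'Z_q}) (x : R) : prime q ->
  g \in relation_hyperplane q a ->
  (M * (2 * Num.trunc (x + 1)).+1 ^ n < q)%N -> (x%:E < Diam R g)%E.
Proof.
move=> pq; rewrite inE => /eqP ga; apply: contraTT; rewrite -leNgt -leqNgt => gx.
rewrite -[q in (q <= _)%N]card_prime_Zp //.
apply: card_le_relation ga _ => [i|v]; last exact: Diam_le_cover gx.
exact: ltn_ord.
Qed.

(** A single generator reaches only its multiples [g ord0 *+ i], hence at most L + 1 elements within
    distance L. *)
Lemma Diam_gt_cyclic (R : realType) q (g : 'I_1 -> 'Z_q) (x : R) : prime q ->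
  ((Num.trunc (x + 1)).+1 < q)%N -> (x%:E < Diam R g)%E.
Proof.
move=> pq; apply: contraTT; rewrite -leNgt -leqNgt => gx.
rewrite -[q in (q <= _)%N]card_prime_Zp //.
rewrite -[(Num.trunc (x + 1)).+1]card_ord.
pose h (i : 'I_(Num.trunc (x + 1)).+1) := g ord0 *+ i.
apply: leq_trans (leq_image_card h _); apply/subset_leq_card/fintype.subsetP => v _.
have [b [bx ->]] := Diam_le_cover v gx; rewrite big_ord1 -ltnS in bx.
by apply/codomP; exists (Ordinal bx); rewrite big_ord1.
Qed.

(** * From counting to probability and the lower limit *)

Section IidUniform.
Context d (Omega : measurableType d) (R : realType) (P : probability Omega R).
Context (I T : finType) (X : I -> Omega -> T).

Lemma prob_iid_uniform (Q : pred {ffun I -> T}) : iid_uniform P X ->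
  P [set w | Q [ffun i => X i w]] = (#|Q|%:R / #|T|%:R ^+ #|I|)%:E.
Proof.
case=> mX uX iX.
(* [E v] is the event that the whole tuple equals [v]; independence over the full index set gives
   its probability, and the events are disjoint. *)
pose E (v : {ffun I -> T}) := \bigcap_(i in [set` [set: I]%SET]) X i @^-1` [set v i].
have EP v w : E v w <-> [ffun i => X i w] = v.
  split=> [Ev|<- i _ /=]; last by rewrite ffunE.
  by apply/ffunP => i; rewrite ffunE; apply: (Ev i); rewrite /= inE.
have mE v : measurable (E v).
  by apply: fin_bigcap_measurable => // i _; exact: mX.
have PE v : P (E v) = (#|T|%:R ^- #|I|)%:E.
  rewrite (iX _ (fun i => [set v i])) -exprVn -[#|I|]cardsT -prodr_const.
  by rewrite -prodEFin; apply: eq_bigr => i _; exact: uX.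
rewrite (_ : [set w | _] = \bigcup_(v in [set` Q]) E v); last first.
  apply/seteqP; split => [w Qw|w [v Qv /EP wv]] /=; last by rewrite wv.
  by exists [ffun i => X i w] => //; apply/EP.
rewrite measure_fin_bigcup //; last first.
  by move=> u v _ _ [w [/EP <- /EP <-]].
rewrite -(@bigfs _ _ _ _ (index_enum _) Q) ?index_enum_uniq //; last first.
  by move=> v _; rewrite mem_index_enum.
rewrite (eq_bigr _ (fun v _ => PE v)) sumEFin sumr_const.
by congr (_%:E); rewrite mulr_natl.
Qed.

End IidUniform.

Lemma limf_einf_primes_gt0 (R : realType) (f : nat -> \bar R) (c : R) (N : nat) :
  0 < c -> (forall q, prime q -> (N <= q)%N -> (c%:E <= f q)%E) ->
  (0 < limf_einf f primes_oo)%E.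
Proof.
move=> c0 fc; apply: (@lt_le_trans _ _ c%:E); first by rewrite lte_fin.
rewrite limf_einfE; apply: le_ereal_sup_tmp.
exists (ereal_inf (f @` [set q | prime q && (N <= q)%N])).
  exists [set q | prime q && (N <= q)%N] => //.
  by exists N => // q /= Nq pq; rewrite /= Nq andbT.
by apply: le_ereal_inf_tmp => _ [q /andP[pq Nq] <-]; exact: fc.
Qed.

Lemma powR_invn_expn (R : realType) (x : R) k : 0 <= x -> (0 < k)%N ->
  (x `^ k%:R^-1) ^+ k = x.
Proof.
move=> x0 k0.
by rewrite -powR_mulrn ?powR_ge0 // -powRrM mulVf ?powRr1 // pnatr_eq0 -lt0n.
Qed.

Lemma prob_Diam_gt_lower (R : realType) n (C : R) : exists (c : R) (N : nat),
  0 < c /\ forall q, prime q -> (N <= q)%N ->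
  forall d (Omega : measurableType d) (P : probability Omega R)
    (g : 'I_n.+2 -> Omega -> 'Z_q), iid_uniform P g ->
  (c%:E <= P [set w | ((C * q%:R `^ n.+2%:R^-1)%:E < Diam R (g ^~ w))%E])%E.
Proof.
(* With s = q^(1/(n+2)) >= 1, [D] satisfies 2L + 1 <= 2(C0 s + 1) + 1 <= D s, and [e] is chosen so
   that e s (D s)^(n+1) = q/2. *)
pose C0 := Num.max C 0; pose D := 2 * C0 + 3; pose e := (2 * D ^+ n.+1)^-1.
have C00 : 0 <= C0 by rewrite le_max lexx orbT.
have D1 : 1 <= D ^+ n.+1 by apply: exprn_ege1; rewrite /D; lra.
have e0 : 0 < e by rewrite invr_gt0; lra.
have e12 : e <= 1 / 2 by rewrite div1r lef_pV2 ?posrE; lra.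
(* The bound [N] forces e s >= 1, hence M >= 1 and M >= e s / 2; the 8 comes from the hyperplane
   count. *)
exists ((e / 2) ^+ n.+2 / 8), (Num.trunc (e ^- n.+2)).+1.
split=> [|q pq Nq d Omega P g iid]; first by rewrite !(divr_gt0, exprn_gt0).
set s := q%:R `^ _.
have sq : s ^+ n.+2 = q%:R by exact: powR_invn_expn.
have s0 : 0 <= s by exact: powR_ge0.
have q0 : 0 < q%:R :> R by rewrite ltr0n prime_gt0.
have es : 1 <= e * s.
  rewrite mulrC -ler_pdivrMr // div1r -(@ler_pXn2r _ n.+2) ?nnegrE //; last first.
    by rewrite invr_ge0 ltW.
  rewrite sq exprVn; apply: le_trans (ltW (truncnS_gt _)) _.
  by rewrite ler_nat.
have s1 : 1 <= s by nra.
pose M := Num.trunc (e * s).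
have Mle : M%:R <= e * s by rewrite truncn_le; lra.
have Mge : e * s / 2 <= M%:R.
  have := truncnS_gt (e * s); rewrite -/M -natr1.
  have : 1 <= M%:R :> R by rewrite ler1n truncn_gt0.
  lra.
have Mq : (M ^ n.+2 < q)%N.
  rewrite -(ltr_nat R) -sq natrX ltr_pXn2r ?nnegrE //.
  by apply: le_lt_trans Mle _; nra.
pose L := Num.trunc (C * s + 1).
have Lq : (M * (2 * L).+1 ^ n.+1 < q)%N.
  have L0 : L%:R <= C0 * s + 1.
    have Cs : C * s + 1 <= C0 * s + 1.
      by rewrite lerD2r ler_wpM2r // le_max lexx.
    case: (leP 0 (C * s + 1)) => h; first by apply: le_trans Cs; rewrite truncn_le.
    (* For negative [C] the argument may be negative, and [Num.trunc] then returns 0. *)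
    have -> : L = 0%N by apply/eqP; rewrite -leqn0 truncn_le_nat; lra.
    by rewrite addr_ge0 // mulr_ge0.
  have LD : (2 * L).+1%:R <= D * s.
    by rewrite -natr1 natrM /D; nra.
  have LDn : (2 * L).+1%:R ^+ n.+1 <= D ^+ n.+1 * s ^+ n.+1.
    by rewrite -exprMn lerXn2r ?nnegrE // (le_trans _ LD).
  rewrite -(ltr_nat R) natrM natrX.
  apply: (@le_lt_trans _ _ (e * s * (D ^+ n.+1 * s ^+ n.+1))).
    by apply: ler_pM => //; rewrite exprn_ge0.
  have -> : e * s * (D ^+ n.+1 * s ^+ n.+1) = s ^+ n.+2 / 2.
    by rewrite [s ^+ n.+2]exprS /e; field; lra.
  rewrite sq; lra.
pose Q (v : {ffun 'I_n.+2 -> 'Z_q}) := `[< ((C * s)%:E < Diam R v)%E >].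
have -> : [set w | ((C * s)%:E < Diam R (g ^~ w))%E] = [set w | Q [ffun i => g i w]].
  apply/seteqP; split=> w /=; rewrite /Q asboolE;
    by have -> : [ffun i => g i w] = g ^~ w :> ('I_n.+2 -> 'Z_q)
      by apply/funext => i; rewrite ffunE.
rewrite prob_iid_uniform // lee_fin card_prime_Zp // card_ord.
rewrite ler_pdivlMr ?exprn_gt0 //.
have UQ : (#|(\bigcup_(a : {ffun 'I_n.+2 -> 'I_M})
    relation_hyperplane q a)%SET| <= #|Q|)%N.
  apply/subset_leq_card/fintype.subsetP => v /finset.bigcupP[a _ va].
  by apply/asboolP; exact: Diam_gt_relation va Lq.
have := leq_trans (card_bigcup_relation_hyperplane pq Mq) (leq_mul (leqnn 8) UQ).
rewrite -(ler_nat R) [leLHS]natrM [leRHS]natrM !natrX => MQ.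
have : (e / 2) ^+ n.+2 * q%:R <= M%:R ^+ n.+2.
  by rewrite -sq -exprMn lerXn2r ?nnegrE // ?mulr_ge0 //; lra.
move=> /(ler_wpM2r (exprn_ge0 n.+1 (ltW q0))) le.
rewrite -mulrA -exprS in le; lra.
Qed.

Theorem theorem2 (R : realType) (k : nat) (C : R)
    (hk : (0 < k)%N) (hC : k = 1%N -> C < 1)
    (disp : nat -> measure_display)
    (Omega : forall q : nat, measurableType (disp q))
    (P : forall q : nat, probability (Omega q) R)
    (g : forall q : nat, 'I_k -> Omega q -> 'Z_q)
    (hg : forall q : nat, prime q -> iid_uniform (P q) (g q)) :
  (0 < limf_einf
         (fun q : nat =>
            P q [set w | (C * (q%:R `^ (k%:R^-1)))%:E < Diam R (g q ^~ w)])
         primes_oo)%E.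
Proof.
case: k => [//|[|n]] in hk hC g hg *; last first.
  have [c [N [c0 lower]]] := prob_Diam_gt_lower n C.
  by apply: (limf_einf_primes_gt0 (N := N) c0) => q pq Nq; apply: lower => //; exact: hg.
(* For k = 1 the event has probability 1 for large [q]: q > 3 / (1 - C) means C q + 1 < q - 2, which
   leaves room for the truncation in [Diam_gt_cyclic]. *)
have C1 : 0 < 1 - C by rewrite subr_gt0 hC.
apply: (@limf_einf_primes_gt0 _ _ 1 (Num.trunc (3 / (1 - C))).+1) => // q pq Nq.
rewrite (_ : [set w | _] = setT) ?probability_setT //.
apply/seteqP; split=> // w _ /=; apply: Diam_gt_cyclic => //.
rewrite invr1 powRr1 //.
have : 3 / (1 - C) < q%:R.
  by apply: lt_le_trans (truncnS_gt _) _; rewrite ler_nat.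
rewrite ltr_pdivrMr // => qC.
have [m qE] : exists m, q = m.+2 by exists q.-2; have := prime_gt1 pq; lia.
rewrite [X in (_ < X)%N]qE !ltnS.
have : q%:R = m.+1%:R + 1 :> R by rewrite qE natr1.
rewrite truncn_le_nat; lra.
Qed.
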